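(* (Bayesian or graphoid intersection property.) Let $W,X,Y,Z$ be four random variables that take values in finite sets and whose joint probability density $P_{W,X,Y,Z}$ is strictly positive. Then $$X\perp Y\mid (Z,W)\ \text{ and }\ X\perp W\mid (Z,Y)\ \implies\ X\perp (Y,W)\mid Z.$$
   Context: For random variables $U,V,T$ with values in finite sets $E_U,E_V,E_T$ and strictly positive joint law, $P_{U|T}(u,t)=P_{U,T}(u,t)/P_T(t)$, and $U\perp V\mid T$ ($U$ is independent of $V$ conditionally to $T$) means that for all $(u,v,t)\in E_U\times E_V\times E_T$, $P_{(U,V)|T}(u,v,t)=P_{U|T}(u,t)\,P_{V|T}(v,t)$. A tuple such as $(Z,W)$ is regarded as a single random variable with values in the product set. Strict positivity of $P_{W,X,Y,Z}$ is on the whole product of the four value sets. *)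

(* Defs.v *)
From HB Require Import structures.
From mathcomp Require Import all_boot all_order all_algebra.
From mathcomp Require Import all_classical all_reals all_analysis.

Set Implicit Arguments.
Unset Strict Implicit.
Unset Printing Implicit Defensive.

Import Order.TTheory GRing.Theory Num.Theory.

Local Open Scope classical_set_scope.
Local Open Scope ring_scope.

(* A finite value set carries the sigma-algebra of all its subsets.  The type
   is also nonempty (measurable types are pointed), which is automatic for the
   codomain of a random variable. *)
Definition finite_discrete d (E : measurableType d) : Prop :=
  finite_set [set: E] /\ forall A : set E, measurable A.

Section joint_random_variable.
Context d dU dV (Omega : measurableType d) (R : realType)
  (P : probability Omega R) (EU : measurableType dU) (EV : measurableType dV).
Variables (U : {RV P >-> EU}) (V : {RV P >-> EV}).

Definition pair_fun (omega : Omega) : EU * EV := (U omega, V omega).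

Lemma measurable_pair_fun : measurable_fun [set: Omega] pair_fun.
Proof. by apply: measurable_fun_pair; exact: measurable_funPT. Qed.

HB.instance Definition _ :=
  isMeasurableFun.Build _ _ _ _ pair_fun measurable_pair_fun.

Definition pair_RV : {RV P >-> (EU * EV)%type} := pair_fun.

End joint_random_variable.

Section conditional_independence.
Context d (Omega : measurableType d) (R : realType) (P : probability Omega R).

Definition law dU (EU : measurableType dU) (U : {RV P >-> EU}) (u : EU) : R :=
  fine (distribution P U [set u]).

(* Only meaningful when [law T t] is positive; otherwise [x / 0 = 0]. *)
Definition cond_law dU dT (EU : measurableType dU) (ET : measurableType dT)
    (U : {RV P >-> EU}) (T : {RV P >-> ET}) (u : EU) (t : ET) : R :=
  law (pair_RV U T) (u, t) / law T t.

Definition cond_indep dU dV dT (EU : measurableType dU)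
    (EV : measurableType dV) (ET : measurableType dT)
    (U : {RV P >-> EU}) (V : {RV P >-> EV}) (T : {RV P >-> ET}) : Prop :=
  forall (u : EU) (v : EV) (t : ET),
    cond_law (pair_RV U V) T (u, v) t = cond_law U T u t * cond_law V T v t.

End conditional_independence.

(* Main.v *)
Require Import Defs.
From mathcomp Require Import all_boot all_order all_algebra.
From mathcomp Require Import all_classical all_reals all_analysis.

(** Write p for the joint density and for its marginals.  With positive
    conditioning laws, a conditional independence is the division-free identity
    p(u,v,t) p(t) = p(u,t) p(v,t) (lemma [cond_indepE]).  So the two hypotheses
    express the conditional law of X given all the other variables in two ways:
    [p(x,z,w) / p(z,w) = p(x,y,z,w) / p(y,z,w) = p(x,z,y) / p(z,y)].
    The left-hand side does not involve y and the right-hand side does not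
    involve w.  Cross-multiplying, [p(x,z,w) p(z,y) = p(x,z,y) p(z,w)] for all
    y and w; summing over w (lemma [law_marginal]) gives
    [p(x,z) p(z,y) = p(x,z,y) p(z)], so the common value is [p(x,z) / p(z)],
    which is the conclusion.  Strict positivity of p is what makes the middle
    ratio available for every pair (y, w), and thus allows comparing the two
    outer ones at unrelated y and w. *)

Local Open Scope classical_set_scope.
Local Open Scope ring_scope.

Import Order.TTheory GRing.Theory Num.Theory.

Section laws.
Set Implicit Arguments.
Context {d} {Omega : measurableType d} {R : realType}
  {P : probability Omega R}.

Lemma finite_discrete_set1 d1 (E : measurableType d1) (u : E) :
  finite_discrete E -> measurable [set u].
Proof. by case=> _; apply. Qed.

Lemma measurable_set1_pair d1 d2 (E1 : measurableType d1)
    (E2 : measurableType d2) (u : E1) (v : E2) :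
  measurable [set u] -> measurable [set v] -> measurable [set (u, v)].
Proof.
move=> mu mv; have -> : [set (u, v)] = [set u] `*` [set v].
  by apply/seteqP; split=> -[a b] /= [-> ->].
exact: measurableX.
Qed.

(** Reorders and reassociates tuples of random variables: the two laws are
    probabilities of the same event. *)
Lemma eq_law dU dV (EU : measurableType dU) (EV : measurableType dV)
    (U : {RV P >-> EU}) (V : {RV P >-> EV}) (u : EU) (v : EV) :
  (forall omega, U omega = u <-> V omega = v) -> law U u = law V v.
Proof.
move=> UV; rewrite /law /distribution /pushforward.
by congr (fine (P _)); apply/seteqP; split=> omega /= /UV.
Qed.

(** Passes positivity from a joint law to its marginals. *)
Lemma law_gt0 dU dV (EU : measurableType dU) (EV : measurableType dV)
    (U : {RV P >-> EU}) (V : {RV P >-> EV}) (u : EU) (v : EV) :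
  measurable [set u] -> measurable [set v] ->
  (forall omega, U omega = u -> V omega = v) -> 0 < law U u -> 0 < law V v.
Proof.
move=> mu mv UV U0; apply: (lt_le_trans U0).
have mU := measurable_funPTI U mu; have mV := measurable_funPTI V mv.
rewrite /law /distribution /pushforward.
by apply: fine_le; [exact: fin_num_measure..|apply: le_measure; rewrite ?inE].
Qed.

Lemma law_marginal dT dV (ET : measurableType dT) (EV : measurableType dV)
    (T : {RV P >-> ET}) (V : {RV P >-> EV}) (t : ET) :
  finite_discrete EV -> measurable [set t] ->
  law T t = \sum_(v \in [set: EV]) law (pair_RV T V) (t, v).
Proof.
move=> [finV mV] mt.
have mTV v : measurable (pair_RV T V @^-1` [set (t, v)]).
  by apply: measurable_funPTI; apply: measurable_set1_pair.
apply: EFin_inj; rewrite -fsumEFin//.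
transitivity (\sum_(v \in [set: EV]) P (pair_RV T V @^-1` [set (t, v)]))%E.
  rewrite -measure_fin_bigcup//; last first.
    by move=> v v' _ _ [omega [/= [_ <-] [_ <-]]].
  rewrite /law /distribution /pushforward fineK; last first.
    by apply: fin_num_measure; exact: measurable_funPTI.
  congr (P _).
  apply/seteqP; split=> [omega /= <-|omega [v _ [/= <- _]]//].
  by exists (V omega).
apply: eq_fsbigr => v _; rewrite /law /distribution /pushforward fineK//.
exact: fin_num_measure.
Qed.

Lemma cond_indepE dU dV dT (EU : measurableType dU) (EV : measurableType dV)
    (ET : measurableType dT) (U : {RV P >-> EU}) (V : {RV P >-> EV})
    (T : {RV P >-> ET}) :
  (forall t, 0 < law T t) ->
  cond_indep U V T <->
  forall u v t, law (pair_RV (pair_RV U V) T) (u, v, t) * law T t =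
                law (pair_RV U T) (u, t) * law (pair_RV V T) (v, t).
Proof.
move=> T0; split=> + u v t => /(_ u v t); rewrite /cond_law;
  have T_neq0 := lt0r_neq0 (T0 t).
  move/(congr1 ( *%R^~ (law T t * law T t))).
  by rewrite mulf_div divfK ?mulf_neq0// mulrA divfK.
by move=> fact_UV; rewrite mulf_div -fact_UV -mulf_div divff// mulr1.
Qed.

End laws.

Theorem proposition5p1
  (d dW dX dY dZ : measure_display)
  (Omega : measurableType d) (R : realType) (P : probability Omega R)
  (EW : measurableType dW) (EX : measurableType dX)
  (EY : measurableType dY) (EZ : measurableType dZ)
  (finW : finite_discrete EW) (finX : finite_discrete EX)
  (finY : finite_discrete EY) (finZ : finite_discrete EZ)
  (W : {RV P >-> EW}) (X : {RV P >-> EX})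
  (Y : {RV P >-> EY}) (Z : {RV P >-> EZ})
  (pos : forall (w : EW) (x : EX) (y : EY) (z : EZ),
    0 < law (pair_RV (pair_RV (pair_RV W X) Y) Z) (w, x, y, z)) :
  cond_indep X Y (pair_RV Z W) -> cond_indep X W (pair_RV Z Y) ->
  cond_indep X (pair_RV Y W) Z.
Proof.
(* The forgotten coordinates are set to the default values: each fixed value of
   them gives a joint event inside the marginal one. *)
have Z0 z : 0 < law Z z.
  apply: law_gt0 (pos point point point z); last by move=> omega [].
  - by do !apply: measurable_set1_pair; exact: finite_discrete_set1.
  - exact: finite_discrete_set1.
have ZW0 zw : 0 < law (pair_RV Z W) zw.
  case: zw => z w.
  apply: law_gt0 (pos w point point z); last by move=> omega [<- _ _ <-].
  - by do !apply: measurable_set1_pair; exact: finite_discrete_set1.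
  - by apply: measurable_set1_pair; exact: finite_discrete_set1.
have ZY0 zy : 0 < law (pair_RV Z Y) zy.
  case: zy => z y.
  apply: law_gt0 (pos point point y z); last by move=> omega [_ _ <- <-].
  - by do !apply: measurable_set1_pair; exact: finite_discrete_set1.
  - by apply: measurable_set1_pair; exact: finite_discrete_set1.
move=> XY_ZW XW_ZY.
have {}XY_ZW := iffLR (cond_indepE X Y (pair_RV Z W) ZW0) XY_ZW.
have {}XW_ZY := iffLR (cond_indepE X W (pair_RV Z Y) ZY0) XW_ZY.
apply: (iffRL (cond_indepE X (pair_RV Y W) Z Z0)) => x [y w] z.
pose pXZ := law (pair_RV X Z) (x, z).
pose pXZY := law (pair_RV (pair_RV X Z) Y) (x, z, y).
pose pXZW w := law (pair_RV (pair_RV X Z) W) (x, z, w).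
pose pYWZ w := law (pair_RV (pair_RV Y W) Z) (y, w, z).
pose pXYWZ w := law (pair_RV (pair_RV X (pair_RV Y W)) Z) (x, (y, w), z).
pose pZY := law (pair_RV Z Y) (z, y).
pose pZW w := law (pair_RV Z W) (z, w).
have hypXY v : pXYWZ v * pZW v = pXZW v * pYWZ v.
  have -> : pXYWZ v =
      law (pair_RV (pair_RV X Y) (pair_RV Z W)) (x, y, (z, v)).
    by apply: eq_law => omega; split=> -[<- <- <- <-].
  have -> : pXZW v = law (pair_RV X (pair_RV Z W)) (x, (z, v)).
    by apply: eq_law => omega; split=> -[<- <- <-].
  have -> : pYWZ v = law (pair_RV Y (pair_RV Z W)) (y, (z, v)).
    by apply: eq_law => omega; split=> -[<- <- <-].
  exact: XY_ZW.
have hypXW v : pXYWZ v * pZY = pXZY * pYWZ v.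
  have -> : pXYWZ v =
      law (pair_RV (pair_RV X W) (pair_RV Z Y)) (x, v, (z, y)).
    by apply: eq_law => omega; split=> -[<- <- <- <-].
  have -> : pXZY = law (pair_RV X (pair_RV Z Y)) (x, (z, y)).
    by apply: eq_law => omega; split=> -[<- <- <-].
  have -> : pYWZ v = law (pair_RV W (pair_RV Z Y)) (v, (z, y)).
    by apply: eq_law => omega; split=> -[<- <- <-].
  exact: XW_ZY.
have pYWZ0 v : 0 < pYWZ v.
  apply: law_gt0 (pos v point y z); last by move=> omega [<- _ <- <-].
  - by do !apply: measurable_set1_pair; exact: finite_discrete_set1.
  - by do !apply: measurable_set1_pair; exact: finite_discrete_set1.
(* Division-free form of p(x,z,w)/p(z,w) = p(x,z,y)/p(z,y), obtained through
   the common value p(x,y,w,z)/p(y,w,z). *)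
have cross v : pXZW v * pZY = pXZY * pZW v.
  apply: (mulIf (lt0r_neq0 (pYWZ0 v))).
  by rewrite mulrAC -hypXY mulrAC hypXW mulrAC.
have sum_cross : pXZ * pZY = pXZY * law Z z.
  rewrite /pXZ (law_marginal _ W)//; last first.
    by apply: measurable_set1_pair; exact: finite_discrete_set1.
  rewrite (law_marginal Z W)//; last exact: finite_discrete_set1.
  rewrite mulr_fsuml mulr_fsumr.
  by apply: eq_fsbigr => v _; exact: cross.
apply: (mulIf (lt0r_neq0 (ZY0 (z, y)))).
by rewrite mulrAC hypXW [RHS]mulrAC sum_cross mulrAC.
Qed.
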